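(* (Double Rolle's theorem) Let $a,b\in\mathbb{R}^2$ satisfy $a<b$. Let $f:[a,b]\to\mathbb{R}$ be a double continuous function on $[a,b]$ which is double differentiable on $(a,b)$. If $\Delta_a^b(f)=0$, then there exists $c\in(a,b)$ with $f'(c)=0$.
   Context: Points of $\mathbb{R}^2$ are written $a=(a_1,a_2)$. For $a,b\in\mathbb{R}^2$: $a<b$ means $a_1<b_1$ and $a_2<b_2$; $a\le b$ means $a_1\le b_1$ and $a_2\le b_2$; $a\nsim b$ means $a_1\ne b_1$ and $a_2\ne b_2$. $[a,b]=\{x\in\mathbb{R}^2: a\le x\le b\}$ and $(a,b)=\{x\in\mathbb{R}^2: a<x<b\}$. A double function is a real-valued function $f$ with domain $D(f)\subseteq\mathbb{R}^2$. The double difference is $\Delta_a^b(f)=f(b_1,b_2)-f(b_1,a_2)-f(a_1,b_2)+f(a_1,a_2)$ (whenever the four values are defined). Double continuity at a point: $f$ is double continuous at $a$ if there is a product $I=I_1\times I_2$ of open intervals with $a\in I\subseteq D(f)$ such that for all $x_1\in I_1$, $\lim_{x_2\to a_2}\Delta_a^{x}(f)=0$, and for all $x_2\in I_2$, $\lim_{x_1\to a_1}\Delta_a^{x}(f)=0$, where $x=(x_1,x_2)$. Signed double continuity: for $\delta=(\delta_1,\delta_2)$ with $\delta_1,\delta_2>0$, let $D_{++}(a,\delta)=[a_1,a_1+\delta_1)\times[a_2,a_2+\delta_2)$, $D_{+-}(a,\delta)=[a_1,a_1+\delta_1)\times(a_2-\delta_2,a_2]$, $D_{-+}(a,\delta)=(a_1-\delta_1,a_1]\times[a_2,a_2+\delta_2)$,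 $D_{--}(a,\delta)=(a_1-\delta_1,a_1]\times(a_2-\delta_2,a_2]$. For signs $\sigma,\tau\in\{+,-\}$, $f$ is $\sigma\tau$-double continuous at $a$ if there is such a $\delta$ with $I:=D_{\sigma\tau}(a,\delta)\subseteq D(f)$ such that for all $x_1\in I_1$, $\lim_{x_2\to a_2^{\tau}}\Delta_a^x(f)=0$ and for all $x_2\in I_2$, $\lim_{x_1\to a_1^{\sigma}}\Delta_a^x(f)=0$ (one-sided limits). $f$ is double continuous on $[a,b]$ if it is double continuous at each interior point of $[a,b]$ and, at each boundary point $p$ of $[a,b]$, it is $\sigma\tau$-double continuous for every sign pair $\sigma\tau$ such that $D_{\sigma\tau}(p,\delta)\subseteq[a,b]$ for some $\delta$. Double differentiability: for $a\nsim x$ put $m_a^x(f)=\Delta_a^x(f)/((x_1-a_1)(x_2-a_2))$. $f$ is double differentiable at $a$ if $D(f)$ contains a product of open intervals containing $a$ and there is a real number $f'(a)$ (the double derivative) such that for every $\epsilon>0$ there is $\delta=(\delta_1,\delta_2)$ with $\delta_1,\delta_2>0$ such that for all $x$ with $0<|x_1-a_1|<\delta_1$ and $0<|x_2-a_2|<\delta_2$, $m_a^x(f)$ is defined and $|m_a^x(f)-f'(a)|<\epsilon$. $f$ is double differentiable on $(a,b)$ if it is so at each point of $(a,b)$. *)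

(* Defs.v *)
From mathcomp Require Import all_boot all_order all_algebra.
From mathcomp Require Import all_classical all_reals all_analysis.

Set Implicit Arguments.
Unset Strict Implicit.
Unset Printing Implicit Defensive.

Import Order.TTheory GRing.Theory Num.Theory.
Import numFieldNormedType.Exports.

Local Open Scope classical_set_scope.
Local Open Scope ring_scope.

Section DoubleFunctions.
Variable R : realType.

Definition plane_lt (a b : R * R) : Prop := a.1 < b.1 /\ a.2 < b.2.

Definition plane_le (a b : R * R) : Prop := a.1 <= b.1 /\ a.2 <= b.2.

Definition plane_nsim (a b : R * R) : Prop := a.1 <> b.1 /\ a.2 <> b.2.

Definition plane_cc (a b : R * R) : set (R * R) :=
  [set x | plane_le a x /\ plane_le x b].

Definition plane_oo (a b : R * R) : set (R * R) :=
  [set x | plane_lt a x /\ plane_lt x b].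

(* A double function is a pair of a domain [D] and a total map [f]; the values
   of [f] outside [D] are junk.  Every notion below that takes [D] only uses
   the values of [f] on [D]. *)

Definition double_diff (f : R * R -> R) (a b : R * R) : R :=
  f (b.1, b.2) - f (b.1, a.2) - f (a.1, b.2) + f (a.1, a.2).

Definition double_diff_defined (D : set (R * R)) (a b : R * R) : Prop :=
  [/\ D (b.1, b.2), D (b.1, a.2), D (a.1, b.2) & D (a.1, a.2)].

Definition double_slope (f : R * R -> R) (a x : R * R) : R :=
  double_diff f a x / ((x.1 - a.1) * (x.2 - a.2)).

Definition double_slope_defined (D : set (R * R)) (a x : R * R) : Prop :=
  plane_nsim a x /\ double_diff_defined D a x.

Definition open_itv (I : set R) : Prop := open I /\ is_interval I.

Definition double_continuous_at (D : set (R * R)) (f : R * R -> R)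
    (a : R * R) : Prop :=
  exists I1 I2 : set R,
    [/\ open_itv I1 /\ open_itv I2,
        (I1 `*` I2) a,
        I1 `*` I2 `<=` D,
        forall x1, I1 x1 ->
          double_diff f a (x1, x2) @[x2 --> a.2^'] --> (0 : R)
      & forall x2, I2 x2 ->
          double_diff f a (x1, x2) @[x1 --> a.1^'] --> (0 : R)].

Inductive sign : Set := Plus | Minus.

Definition signed_itv (s : sign) (x d : R) : set R :=
  match s with
  | Plus => [set y | x <= y < x + d]
  | Minus => [set y | x - d < y <= x]
  end.

Definition signed_nbhs (s : sign) (x : R) : set_system R :=
  match s with
  | Plus => x^'+
  | Minus => x^'-
  end.

Definition quadrant (s t : sign) (a d : R * R) : set (R * R) :=
  signed_itv s a.1 d.1 `*` signed_itv t a.2 d.2.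

Definition signed_double_continuous_at (s t : sign) (D : set (R * R))
    (f : R * R -> R) (a : R * R) : Prop :=
  exists d : R * R,
    [/\ 0 < d.1 /\ 0 < d.2,
        quadrant s t a d `<=` D,
        forall x1, signed_itv s a.1 d.1 x1 ->
          double_diff f a (x1, x2) @[x2 --> signed_nbhs t a.2] --> (0 : R)
      & forall x2, signed_itv t a.2 d.2 x2 ->
          double_diff f a (x1, x2) @[x1 --> signed_nbhs s a.1] --> (0 : R)].

Definition double_continuous_on_cc (D : set (R * R)) (f : R * R -> R)
    (a b : R * R) : Prop :=
  (forall p, (plane_cc a b)° p -> double_continuous_at D f p) /\
  (forall p, (closure (plane_cc a b) `\` (plane_cc a b)°) p ->
     forall s t : sign,
       (exists d : R * R,
          [/\ 0 < d.1, 0 < d.2 & quadrant s t p d `<=` plane_cc a b]) ->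
       signed_double_continuous_at s t D f p).

(* [f'(a) = l], as a relation: such an [l] is unique when it exists. *)
Definition is_double_derivative (D : set (R * R)) (f : R * R -> R)
    (a : R * R) (l : R) : Prop :=
  (exists I1 I2 : set R,
     [/\ open_itv I1, open_itv I2, (I1 `*` I2) a & I1 `*` I2 `<=` D]) /\
  (forall e : R, 0 < e ->
     exists d : R * R,
       (0 < d.1 /\ 0 < d.2) /\
       (forall x : R * R,
          0 < `|x.1 - a.1| < d.1 -> 0 < `|x.2 - a.2| < d.2 ->
          double_slope_defined D a x /\ `|double_slope f a x - l| < e)).

Definition double_differentiable_at (D : set (R * R)) (f : R * R -> R)
    (a : R * R) : Prop :=
  exists l : R, is_double_derivative D f a l.

Definition double_differentiable_on_oo (D : set (R * R)) (f : R * R -> R)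
    (a b : R * R) : Prop :=
  forall p, plane_oo a b p -> double_differentiable_at D f p.

End DoubleFunctions.

(* Main.v *)
Require Import Defs.
From mathcomp Require Import all_boot all_order all_algebra.
From mathcomp Require Import all_classical all_reals all_analysis.
From mathcomp Require Import ring lra.
Import Order.TTheory GRing.Theory Num.Theory.
Import numFieldNormedType.Exports.
Local Open Scope classical_set_scope.
Local Open Scope ring_scope.

(** Double continuity says that the increment y |-> f(x', y) - f(x, y) is
    continuous at each y as soon as x' is close to x; connectedness of the first
    side of [a, b] extends this to all pairs x, x', and symmetrically in the
    other coordinate.  If the double difference vanishes on a rectangle, a
    one-variable chord lemma applied to these increments, first in one
    coordinate and then in the other, gives a strictly interior rectangle, with
    sides divided by 3, on which it vanishes again.  The nested rectangles shrink
    to a point c interior to all of them, and f'(c) is the limit of their slopes,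
    that is 0. *)

(** * One-variable tools: connectedness and chords *)

(** Supremum argument: the points of [[p, q]] related to [p] have a supremum, itself related to [p],
    through [EL] unless it equals [p]; were it below [q], [ER] would push past it. With the local
    hypothesis split by sides, [a] and [b] need only their inner side. *)
Lemma itv_connected_rel (R : realType) (E : R -> R -> Prop) (a b : R) :
  (forall x y, E x y -> E y x) ->
  (forall x y z, E x y -> E y z -> E x z) ->
  (forall p, a <= p < b ->
    exists2 d, 0 < d & forall y, signed_itv Plus p d y -> E p y) ->
  (forall p, a < p <= b ->
    exists2 d, 0 < d & forall y, signed_itv Minus p d y -> E p y) ->
  forall p q, a <= p -> p < q -> q <= b -> E p q.
Proof.
move=> Esym Etr ER EL p q ap pq qb.
pose S := [set x | p <= x <= q /\ E p x].
have Spp : S p.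
  split; first lra.
  have [|d d0 /(_ p) H] := ER p; first lra.
  by apply: H => /=; lra.
have Sub : has_ubound S by exists q => x [/andP[]].
have Ssup : has_sup S by split => //; exists p.
have ps : p <= sup S := ub_le_sup Sub Spp.
have sq : sup S <= q by apply: ge_sup; [exists p | move=> x [/andP[]]].
have Es : E p (sup S).
  have [<-|psn] := eqVneq p (sup S); first by case: Spp.
  have {}ps : p < sup S by rewrite lt_neqAle psn.
  have [|d d0 H] := EL (sup S); first lra.
  have [y Sy sy] := sup_adherent d0 Ssup.
  have ys := ub_le_sup Sub Sy.
  case: Sy => _ Ey; apply: Etr Ey _; apply: Esym; apply: H => /=.
  by rewrite sy.
have [<-//|sqn] := eqVneq (sup S) q.
have {}sq : sup S < q by rewrite lt_neqAle sqn.
have [|d d0 H] := ER (sup S); first lra.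
(* Half of [d], since the signed interval is open at its far end; the minimum keeps [y] below or at
   [q]. *)
pose y := sup S + Num.min (d / 2) (q - sup S).
have y1 : y <= sup S + d / 2 by rewrite lerD2l ge_min lexx.
have y2 : y <= q by rewrite -lerBrDl ge_min lexx orbT.
have y3 : sup S < y.
  by rewrite ltrDl lt_min; apply/andP; split; lra.
have Sy : S y.
  split; first lra.
  by apply: (Etr _ _ _ Es); apply: H => /=; lra.
have := ub_le_sup Sub Sy; lra.
Qed.

(* With h = (b - a) / 3, the increments of g over the three thirds of [a, b] sum
   to 0: either the middle one vanishes, or one of the outer ones has the
   opposite sign, and the intermediate value theorem gives a vanishing one. *)
Lemma chord_third (R : realType) (g : R -> R) (a b : R) :
  a < b -> {within `[a, b], continuous g} -> g a = g b ->
  exists p q, [/\ a < p, p < q, q < b, q - p = (b - a) / 3 & g p = g q].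
Proof.
move=> ab gc gab.
pose h := (b - a) / 3.
have h0 : 0 < h by rewrite /h; lra.
have bE : b = a + 3 * h by rewrite /h; field.
pose k x := g (x + h) - g x.
have kc : {within `[a, b - h], continuous k}.
  move: gc => /subspace_continuousP gc; apply/subspace_continuousP => x /=.
  rewrite in_itv /= => /andP[ax xb].
  apply: cvgB.
    have : g y @[y --> within `[a, b] (nbhs (x + h))] --> g (x + h).
      by apply: gc; rewrite /= in_itv /=; lra.
    apply: cvg_trans; move=> P [e /= e0 He].
    exists e => //= y xy; rewrite in_itv /= => /andP[ay yb].
    apply: (He (y + h)) => /=; last by rewrite in_itv /=; lra.
    by rewrite opprD addrACA subrr addr0.
  have : g y @[y --> within `[a, b] (nbhs x)] --> g x.
    by apply: gc; rewrite /= in_itv /=; lra.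
  apply: cvg_trans; move=> P [e /= e0 He].
  exists e => //= y xy; rewrite in_itv /= => /andP[ay yb].
  by apply: (He y) => //=; rewrite in_itv /=; lra.
(* The strict sign change keeps the root off [u] and [v], so the chord found is strictly
   interior. *)
have kroot u v : a <= u -> u < v -> v <= b - h -> k u * k v < 0 ->
    exists2 c, u < c < v & k c = 0.
  move=> au uv vb kuv.
  have kc' : {within `[u, v], continuous k}.
    apply: continuous_subspaceW kc => y /=; rewrite !in_itv /=; lra.
  have [|c] := @IVT _ k u v 0 (ltW uv) kc'.
    by rewrite ge_min le_max; nra.
  rewrite in_itv /= => cuv kc0; exists c => //.
  have cu : c != u by apply: contraTneq kuv => <-; rewrite kc0 mul0r ltxx.
  have cv : c != v by apply: contraTneq kuv => <-; rewrite kc0 mulr0 ltxx.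
  by rewrite !lt_neqAle cv eq_sym cu.
suff [c cab kc0] : exists2 c, a < c < b - h & k c = 0.
  exists c, (c + h); split; try lra.
  by apply/esym/eqP; rewrite -subr_eq0; apply/eqP.
have ksum : k a + k (a + h) + k (a + 2 * h) = 0.
  rewrite /k gab bE.
  have -> : a + h + h = a + 2 * h by ring.
  have -> : a + 2 * h + h = a + 3 * h by ring.
  ring.
have [k1|k1|k1] := ltgtP (k (a + h)) 0; last by exists (a + h) => //; lra.
- have [k0|k0] := ltP 0 (k a).
    have [|||| c ? ?] := kroot a (a + h); try lra; first nra.
    by exists c => //; lra.
  have [|||| c ? ?] := kroot (a + h) (a + 2 * h); try lra; first nra.
  by exists c => //; lra.
- have [k0|k0] := ltP (k a) 0.
    have [|||| c ? ?] := kroot a (a + h); try lra; first nra.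
    by exists c => //; lra.
  have [|||| c ? ?] := kroot (a + h) (a + 2 * h); try lra; first nra.
  by exists c => //; lra.
Qed.

(** * Continuity of the increments *)

(** On its side [s], the point [x] of [[a, b]] has a nontrivial interval that stays in [[a, b]]. *)
Definition signed_room {R : realType} (s : sign) (a b x : R) : Prop :=
  match s with Plus => a <= x < b | Minus => a < x <= b end.

#[local] Instance signed_nbhs_filter (R : realType) (s : sign) (x : R) :
  Filter (signed_nbhs s x).
Proof. by case: s; rewrite /signed_nbhs; typeclasses eauto. Qed.

(** [F] is curried so that swapping its arguments gives the same result for the other coordinate. *)
Lemma difference_continuous (R : realType) (F : R -> R -> R)
    (a1 b1 a2 b2 : R) : a2 < b2 ->
  (forall s t x y, signed_room s a1 b1 x -> signed_room t a2 b2 y ->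
    exists2 d, 0 < d & forall x', signed_itv s x d x' ->
      F x' y' - F x' y - F x y' + F x y @[y' --> signed_nbhs t y] --> (0 : R)) ->
  forall p q, a1 <= p -> p < q -> q <= b1 ->
    {within `[a2, b2], continuous (fun y => F q y - F p y)}.
Proof.
move=> ab2 H p q ap pq qb.
have K t y : signed_room t a2 b2 y ->
    F q y' - F p y' @[y' --> signed_nbhs t y] --> F q y - F p y.
  move=> ty.
  (* [E x x'] is continuity at [y], from the side [t], of the increment from [x] to [x']. Increments
     add up, so [E] is symmetric and transitive, and [H] supplies it locally. *)
  pose E x x' :=
    F x' y' - F x' y - F x y' + F x y @[y' --> signed_nbhs t y] --> (0 : R).
  have Esym x x' : E x x' -> E x' x.
    move=> /cvgN; rewrite oppr0; apply: cvg_trans; apply: near_eq_cvg.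
    by apply: nearW => z; rewrite !fctE /=; ring.
  have Etr x x' x'' : E x x' -> E x' x'' -> E x x''.
    rewrite /E => e1 e2; have := cvgD (FF := signed_nbhs_filter R t y) e1 e2; rewrite addr0.
    apply: cvg_trans; apply: near_eq_cvg.
    by apply: nearW => z; rewrite !fctE /=; ring.
  have Epq : E p q.
    apply: (@itv_connected_rel R E a1 b1 Esym Etr) => // x xr.
      exact: (H Plus t).
    exact: (H Minus t).
  have c0 := cvg_cst (F q y - F p y) (FF := signed_nbhs_filter R t y).
  have := cvgD (FF := signed_nbhs_filter R t y) Epq c0; rewrite add0r.
  apply: cvg_trans; apply: near_eq_cvg.
  by apply: nearW => z; rewrite !fctE /=; ring.
apply/continuous_within_itvP => //; split.
- move=> y; rewrite in_itv /= => yab; apply/left_right_continuousP; split.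
    by apply: (K Minus); rewrite /=; lra.
  by apply: (K Plus); rewrite /=; lra.
- by apply: (K Plus); rewrite /=; lra.
- by apply: (K Minus); rewrite /=; lra.
Qed.

Lemma double_continuous_at_signed (R : realType) (D : set (R * R))
    (f : R * R -> R) (p : R * R) (s t : sign) :
  double_continuous_at D f p -> signed_double_continuous_at s t D f p.
Proof.
case=> I1 [I2] [[[I1o _] [I2o _]] [/= p1 p2] ID c1 c2].
have itv (I : set R) u x : open I -> I x ->
    exists2 d, 0 < d & signed_itv u x d `<=` I.
  move=> oI Ix; have /nbhs_ballP[d /= d0 dI] := open_nbhs_nbhs (conj oI Ix).
  exists d => // y yd; apply: dI; rewrite /ball /= ltr_norml.
  by case: u yd => /= yd; lra.
have [d1 d10 H1] := itv _ s _ I1o p1.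
have [d2 d20 H2] := itv _ t _ I2o p2.
exists (d1, d2); split => //.
- by move=> x [/= /H1 ? /H2 ?]; apply: ID.
- move=> x1 /H1 /c1 h; case: (t) => /=.
    exact: cvg_dnbhs_at_right.
  exact: cvg_dnbhs_at_left.
- move=> x2 /H2 /c2 h; case: (s) => /=.
    exact: cvg_dnbhs_at_right.
  exact: cvg_dnbhs_at_left.
Qed.

(** Merges interior and boundary points: in the interior the two-sided limits give every sign pair,
    and on the boundary the two rooms give a quadrant inside the rectangle. *)
Lemma double_continuous_on_cc_signed (R : realType) (a b : R * R)
    (D : set (R * R)) (f : R * R -> R) (s t : sign) (x y : R) :
  double_continuous_on_cc D f a b ->
  signed_room s a.1 b.1 x -> signed_room t a.2 b.2 y ->
  signed_double_continuous_at s t D f (x, y).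
Proof.
move=> [fin fbd] sx ty.
have xyab : plane_cc a b (x, y).
  by split; split => /=; [case: s sx|case: t ty|case: s sx|case: t ty] => /= ?; lra.
have [/fin|nin] := pselect ((plane_cc a b)° (x, y)).
  exact: double_continuous_at_signed.
apply: fbd; first by split => //; apply: subset_closure.
have room u (l r z : R) : signed_room u l r z ->
    exists2 d, 0 < d & forall z', signed_itv u z d z' -> l <= z' <= r.
  case: u => /= zr; [exists (r - z)|exists (z - l)]; try lra.
  - by move=> z'; lra.
  - by move=> z'; lra.
have [d1 d10 H1] := room _ _ _ _ sx.
have [d2 d20 H2] := room _ _ _ _ ty.
exists (d1, d2); split => // z [/= /H1 ? /H2 ?].
by split; split; lra.
Qed.

(** * Double differences on small rectangles *)

Lemma double_diff_third (R : realType) (a b p q : R * R) (f : R * R -> R) :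
  double_continuous_on_cc (plane_cc a b) f a b ->
  plane_le a p -> plane_lt p q -> plane_le q b -> double_diff f p q = 0 ->
  exists p' q', [/\ plane_lt p p', plane_lt p' q', plane_lt q' q,
    q' - p' = 3^-1 *: (q - p) & double_diff f p' q' = 0].
Proof.
case: a b p q => [a1 a2] [b1 b2] [p1 p2] [q1 q2] /= fc.
rewrite /plane_le /plane_lt /double_diff /= => -[ap1 ap2] [pq1 pq2] [qb1 qb2] f0.
(* The increment from [p2] to [q2] takes equal values at [p1] and [q1] exactly because [f0]
   holds. *)
have [||u1 [v1 [pu1 uv1 vq1 l1 e1]]] :=
    @chord_third R (fun x => f (x, q2) - f (x, p2)) p1 q1 pq1.
- have := @difference_continuous R (fun y x => f (x, y)) a2 b2 a1 b1.
  move=> /(_ _ _ p2 q2 ap2 pq2 qb2) H.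
  have {}H : {within `[a1, b1], continuous (fun x => f (x, q2) - f (x, p2))}.
    apply: H; first lra.
    move=> t s y x ty sx.
    have [d [/= [_ d20] _ _ c]] :=
      double_continuous_on_cc_signed R (a1, a2) (b1, b2) _ f s t x y fc sx ty.
    exists d.2 => // y' /c; apply: cvg_trans; apply: near_eq_cvg.
    by apply: nearW => z /=; rewrite /double_diff /=; ring.
  apply: (continuous_subspaceW _ H) => z /=; rewrite !in_itv /=; lra.
- lra.
(* Here the equal end values are [e1]: the double difference vanishes on [[u1, v1]] times
   [[p2, q2]]. *)
have [||u2 [v2 [pu2 uv2 vq2 l2 e2]]] :=
    @chord_third R (fun y => f (v1, y) - f (u1, y)) p2 q2 pq2.
- have := @difference_continuous R (fun x y => f (x, y)) a1 b1 a2 b2.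
  move=> /(_ _ _ u1 v1) H.
  have {}H : {within `[a2, b2], continuous (fun y => f (v1, y) - f (u1, y))}.
    apply: H; try lra.
    move=> s t x y sx ty.
    have [d [/= [d10 _] _ c _]] :=
      double_continuous_on_cc_signed R (a1, a2) (b1, b2) _ f s t x y fc sx ty.
    by exists d.1.
  apply: (continuous_subspaceW _ H) => z /=; rewrite !in_itv /=; lra.
- lra.
exists (u1, u2), (v1, v2); split => //=; last lra.
by congr pair => /=; rewrite ?l1 ?l2 /GRing.scale /= mulrC.
Qed.

(* Cutting the rectangle at [c] writes its double difference as a signed sum of
   four double differences with corner [c], to which the definition applies. *)
Lemma double_derivative_rect (R : realType) (D : set (R * R))
    (f : R * R -> R) (c : R * R) (l : R) :
  is_double_derivative D f c l ->
  forall e, 0 < e -> exists d : R * R, (0 < d.1 /\ 0 < d.2) /\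
    forall p q, plane_le p c -> plane_le c q ->
      q.1 - p.1 < d.1 -> q.2 - p.2 < d.2 ->
      `|double_diff f p q - l * ((q.1 - p.1) * (q.2 - p.2))|
        <= e * ((q.1 - p.1) * (q.2 - p.2)).
Proof.
move=> [_ fl] e e0; have [d [d0 H]] := fl e e0.
exists d; split => // p q [p1 p2] [q1 q2] pq1 pq2.
have K x : `|x.1 - c.1| < d.1 -> `|x.2 - c.2| < d.2 ->
    `|double_diff f c x - l * ((x.1 - c.1) * (x.2 - c.2))|
      <= e * (`|x.1 - c.1| * `|x.2 - c.2|).
  move=> xd1 xd2.
  (* The slope is undefined on the two lines through [c], but there both sides of the bound are 0;
     this covers [c] on an edge of the rectangle. *)
  have [x1|x1] := eqVneq x.1 c.1.
    have -> : double_diff f c x = 0 by rewrite /double_diff x1; ring.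
    by rewrite x1 subrr normr0 ?mul0r !mulr0 subrr normr0.
  have [x2|x2] := eqVneq x.2 c.2.
    have -> : double_diff f c x = 0 by rewrite /double_diff x2; ring.
    by rewrite x2 subrr normr0 ?mul0r !mulr0 subrr normr0.
  have [||_ sl] := H x; rewrite ?xd1 ?xd2 ?andbT ?normr_gt0 ?subr_eq0 //.
  have A0 : (x.1 - c.1) * (x.2 - c.2) != 0 by rewrite mulf_neq0 ?subr_eq0.
  rewrite -normrM -[double_diff f c x](divfK A0) -mulrBl [leLHS]normrM.
  by rewrite ler_wpM2r ?normr_ge0 // ltW.
have n1 : `|p.1 - c.1| = c.1 - p.1 by rewrite distrC ger0_norm // subr_ge0.
have n2 : `|p.2 - c.2| = c.2 - p.2 by rewrite distrC ger0_norm // subr_ge0.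
have n3 : `|q.1 - c.1| = q.1 - c.1 by rewrite ger0_norm // subr_ge0.
have n4 : `|q.2 - c.2| = q.2 - c.2 by rewrite ger0_norm // subr_ge0.
(* The areas of the four pieces add up to that of the rectangle, and so do the error bounds. *)
have := K (q.1, q.2); have := K (q.1, p.2).
have := K (p.1, q.2); have := K (p.1, p.2).
rewrite /= n1 n2 n3 n4 /double_diff /= => Kpp Kpq Kqp Kqq.
have {Kpp} := Kpp ltac:(lra) ltac:(lra); rewrite ler_norml => /andP[? ?].
have {Kpq} := Kpq ltac:(lra) ltac:(lra); rewrite ler_norml => /andP[? ?].
have {Kqp} := Kqp ltac:(lra) ltac:(lra); rewrite ler_norml => /andP[? ?].
have {Kqq} := Kqq ltac:(lra) ltac:(lra); rewrite ler_norml => /andP[? ?].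
by rewrite ler_norml; apply/andP; split; lra.
Qed.

(** * Nested rectangles and the conclusion *)

Lemma nested_rectangles (R : realType) (p q : nat -> R * R) :
  (forall n, plane_lt (p n) (p n.+1)) ->
  (forall n, plane_lt (q n.+1) (q n)) ->
  (forall n, plane_lt (p n) (q n)) ->
  exists c, forall n, plane_lt (p n) c /\ plane_lt c (q n).
Proof.
move=> pS qS pq.
have nested (u v : nat -> R) : (forall n, u n < u n.+1) ->
    (forall n, v n.+1 < v n) -> (forall n, u n < v n) ->
    exists c, forall n, u n < c /\ c < v n.
  move=> uS vS uv.
  have um : {homo u : m n / (m <= n)%N >-> m <= n}.
    by apply: homo_leq => [x //| y x z|n]; [apply: le_trans | apply: ltW].
  have vm : {homo v : m n / (m <= n)%N >-> n <= m}.
    by apply: homo_leq => [x //| y x z yx zy|n]; [apply: le_trans zy yx | apply: ltW].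
  have uvmn m n : u m <= v n.
    apply: le_trans (um _ _ (leq_maxl m n)) _.
    exact: le_trans (ltW (uv _)) (vm _ _ (leq_maxr m n)).
  exists (sup (range u)) => n; split.
    (* Passing to index [n.+1] makes the inequality strict. *)
    apply: (lt_le_trans (uS n)); apply: ub_le_sup; last by exists n.+1.
    by exists (v 0) => _ [m _ <-].
  apply: (le_lt_trans _ (vS n)); apply: ge_sup; first by exists (u 0), 0.
  by move=> _ [m _ <-].
have [c1 H1] := nested (fun n => (p n).1) (fun n => (q n).1)
  (fun n => (pS n).1) (fun n => (qS n).1) (fun n => (pq n).1).
have [c2 H2] := nested (fun n => (p n).2) (fun n => (q n).2)
  (fun n => (pS n).2) (fun n => (qS n).2) (fun n => (pq n).2).
exists (c1, c2) => n; have [? ?] := H1 n; have [? ?] := H2 n.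
by split; split.
Qed.

Theorem proposition17 (R : realType) (a b : R * R) (f : R * R -> R)
  (ab : plane_lt a b)
  (fcont : double_continuous_on_cc (plane_cc a b) f a b)
  (fdiff : double_differentiable_on_oo (plane_cc a b) f a b)
  (fab : double_diff f a b = 0) :
  exists c : R * R,
    plane_oo a b c /\ is_double_derivative (plane_cc a b) f c 0.
Proof.
pose good (r : (R * R) * (R * R)) := [/\ plane_le a r.1, plane_lt r.1 r.2,
  plane_le r.2 b & double_diff f r.1 r.2 = 0].
pose next (r r' : (R * R) * (R * R)) := [/\ plane_lt r.1 r'.1,
  plane_lt r'.2 r.2 & r'.2 - r'.1 = 3^-1 *: (r.2 - r.1)].
(* Choice needs a total [g]; off the good rectangles its value is irrelevant. *)
have [g gP] : {g & forall r, good r -> good (g r) /\ next r (g r)}.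
  apply: (choice (P := fun r r' => good r -> good r' /\ next r r')) => -[p q].
  have [[/= ap pq qb f0]|] := pselect (good (p, q)); last by exists (p, q).
  have [p' [q' [pp pq' qq l f0']]] :=
    double_diff_third R a b p q f fcont ap pq qb f0.
  exists (p', q') => _; split; split => //=.
  - by case: ap pp => ? ? [? ?]; split; lra.
  - by case: qb qq => ? ? [? ?]; split; lra.
pose r n := iter n g (a, b).
have rgood n : good (r n).
  elim: n => [|n IH]; first by split => //; split.
  by have [] := gP _ IH.
have rnext n : next (r n) (r n.+1) by have [] := gP _ (rgood n).
have rlen n : (r n).2 - (r n).1 = 3^-1 ^+ n *: (b - a).
  elim: n => [|n IH]; first by rewrite expr0 scale1r.
  by have [_ _ ->] := rnext n; rewrite IH scalerA exprS.
have [c rc] : exists c, forall n, plane_lt (r n).1 c /\ plane_lt c (r n).2.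
  apply: (nested_rectangles R (fun n => (r n).1) (fun n => (r n).2)) => n.
  - by have [] := rnext n.
  - by have [] := rnext n.
  - by have [] := rgood n.
(* The rectangle of index 0 is [[a, b]] itself. *)
have cab : plane_oo a b c := rc 0%N.
exists c; split => //.
have [l fl] := fdiff c cab.
suff <- : l = 0 by [].
apply/eqP; apply: contraT => l0.
(* On a rectangle of area A > 0 with zero double difference, this tolerance gives |l| A <= (|l| / 2)
   A, which is absurd. *)
have e0 : 0 < `|l| / 2 by rewrite divr_gt0 ?normr_gt0.
have [d [[d1 d2] H]] := double_derivative_rect R _ f c l fl _ e0.
have small (u v : R) : 0 < v -> \forall n \near \oo, 3^-1 ^+ n * u < v.
  move=> v0.
  have : 3^-1 ^+ n * u @[n --> \oo] --> (0 : R).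
    rewrite -[X in _ --> X](mul0r u); apply: cvgMr_tmp.
    by apply: cvg_expr; rewrite ger0_norm; lra.
  by move=> /cvgr_lt; apply.
have [n [/= n1 n2]] : exists n,
    3^-1 ^+ n * (b - a).1 < d.1 /\ 3^-1 ^+ n * (b - a).2 < d.2.
  near \oo => n; exists n; split; near: n; exact: small.
have [_ [pq1 pq2] _ f0] := rgood n.
have [[pc1 pc2] [cq1 cq2]] := rc n.
have E1 : (r n).2.1 - (r n).1.1 = 3^-1 ^+ n * (b - a).1.
  by rewrite -[LHS]/((r n).2 - (r n).1).1 rlen.
have E2 : (r n).2.2 - (r n).1.2 = 3^-1 ^+ n * (b - a).2.
  by rewrite -[LHS]/((r n).2 - (r n).1).2 rlen.
have := H (r n).1 (r n).2; rewrite E1 E2 f0 => /(_ _ _ n1 n2).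
rewrite -E1 -E2 sub0r normrN normrM.
have A0 : 0 < ((r n).2.1 - (r n).1.1) * ((r n).2.2 - (r n).1.2).
  by rewrite mulr_gt0 // subr_gt0.
rewrite (gtr0_norm A0) ler_pM2r // => K.
have : `|l| <= `|l| / 2 by apply: K; split; apply: ltW.
by move: l0; rewrite -normr_gt0 => l0; lra.
Unshelve. all: by end_near.
Qed.
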